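(* Let $\pi,\tilde\pi:\{0,1\}^*\to\{0,1\}^*$ be the morphisms given by $\pi(0)=0$, $\pi(1)=10$ and $\tilde\pi(0)=0$, $\tilde\pi(1)=01$. (1) Let $m>n\geq 1$ be integers and let $\beta>1$ be the root of $x^2-mx-n$. Then $\mathcal{L}(u_\beta)=\mathcal{L}\big(\tilde\pi(u_{-\beta})\big)$. Moreover, $u_\beta=\pi(u_{-\beta}^+)$ for $n=1$. (2) Let $m,n$ be integers with $m-2\geq n\geq 1$ and let $\beta>1$ be the (larger) root of $x^2-mx+n$. Then $\mathcal{L}(u_\beta)=\mathcal{L}\big(\pi(u_{-\beta})\big)$.
   Context: **Words.** The language $\mathcal{L}(u)$ of a (one- or bidirectional) infinite word $u$ is the set of all its finite factors. A morphism acts on infinite words letter by letter, $\sigma(\cdots u_{-1}|u_0u_1\cdots)=\cdots\sigma(u_{-1})|\sigma(u_0)\sigma(u_1)\cdots$, and similarly for one-directional words. **$\beta$-integers.** For $\beta>1$ let $T_\beta(x)=\beta x-\lfloor\beta x\rfloor$ on $[0,1)$, and for $x\in[0,1)$ put $d_\beta(x)=y_1y_2y_3\cdots$ with $y_i=\lfloor\beta T_\beta^{i-1}(x)\rfloor$. For real $x\geq 0$ choose an integer $k\ge 0$ with $x/\beta^k\in[0,1)$; if $d_\beta(x/\beta^k)=y_1y_2\cdots$, then $x$ is said to have an integer $\beta$-expansion if $y_i=0$ for all $i>k$ (this does not depend on the choice of $k$). $\mathbb{Z}_\beta^+$ is the set of all $x\geq 0$ with integer $\beta$-expansion, and $\mathbb{Z}_\beta=\mathbb{Z}_\beta^+\cup(-\mathbb{Z}_\beta^+)$.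 **$(-\beta)$-integers.** Let $l=-\frac{\beta}{\beta+1}$, $I=[l,l+1)$, $T(x)=-\beta x-\lfloor-\beta x-l\rfloor$ on $I$, and for $x\in I$ put $d_{-\beta}(x)=y_1y_2y_3\cdots$ with $y_i=\lfloor-\beta T^{i-1}(x)-l\rfloor$. For $x\in\mathbb{R}$ choose an integer $k\geq 0$ with $x/(-\beta)^k\in(l,l+1)$; if $d_{-\beta}(x/(-\beta)^k)=y_1y_2\cdots$, then $x\in\mathbb{Z}_{-\beta}$ if and only if $y_i=0$ for all $i>k$ (this does not depend on the choice of $k$). **Coding words.** The distances between consecutive elements of $\mathbb{Z}_\beta$ take the values $\Delta_0^+=1$ and $\Delta_1^+=\frac n\beta$ if $\beta^2=m\beta+n$ ($m>n\geq1$), resp. $\Delta_1^+=1-\frac n\beta$ if $\beta^2=m\beta-n$ ($m-2\geq n\geq 1$). The distances between consecutive elements of $\mathbb{Z}_{-\beta}$ take the values $\Delta_0^-=1$ and $\Delta_1^-=1+\frac n\beta$ if $\beta^2=m\beta+n$ ($m>n\geq 1$), resp. $\Delta_1^-=2-\frac n\beta$ if $\beta^2=m\beta-n$ ($m-2\geq n\geq 1$). Writing $\mathbb{Z}_\beta=\{t_j\mid j\in\mathbb{Z}\}$ with $t_0=0$, $t_j<t_{j+1}$, the word $u_\beta=u_0u_1u_2\cdots\in\{0,1\}^{\mathbb{N}}$ is defined by $u_j=X$ if $t_{j+1}-t_j=\Delta_X^+$. Writing $\mathbb{Z}_{-\beta}=\{t_j\mid j\in\mathbb{Z}\}$ with $t_0=0$,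 $t_j<t_{j+1}$, the pointed bidirectional word $u_{-\beta}=\cdots u_{-2}u_{-1}|u_0u_1u_2\cdots\in\{0,1\}^{\mathbb{Z}}$ is defined by $u_j=X$ if $t_{j+1}-t_j=\Delta_X^-$, and $u_{-\beta}^+=u_0u_1u_2\cdots$ is its part to the right of the delimiter. *)

(* Defs.v *)
From HB Require Import structures.
From mathcomp Require Import all_boot all_order all_algebra.
From mathcomp Require Import all_classical all_reals.
Set Implicit Arguments.
Unset Strict Implicit.
Unset Printing Implicit Defensive.
Import Order.TTheory GRing.Theory Num.Theory.
Local Open Scope classical_set_scope.
Local Open Scope ring_scope.

(** The letter 0 is [false] and the letter 1 is [true].
    One-directional words are functions on [nat], pointed bidirectional words
    are functions on [int] with the delimiter just before position 0. *)

Definition language_nat (u : nat -> bool) : set (seq bool) :=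
  [set w | exists i : nat, w = mkseq (fun k => u (i + k)%N) (size w)].

Definition language_int (u : int -> bool) : set (seq bool) :=
  [set w | exists i : int, w = mkseq (fun k => u (i + k%:Z)) (size w)].

Definition morphism (s : bool -> seq bool) (w : seq bool) : seq bool :=
  flatten (map s w).

Definition pi_morph : seq bool -> seq bool :=
  morphism (fun a => if a then [:: true; false] else [:: false]).
Definition pi_tilde_morph : seq bool -> seq bool :=
  morphism (fun a => if a then [:: false; true] else [:: false]).

(** Action of a non-erasing morphism on infinite words. As every letter has a
    non-empty image, the images of the [j.+1] letters next to the delimiter have
    total length at least [j.+1], so the default of [nth] is never returned. *)
Definition morph_nat (f : seq bool -> seq bool) (u : nat -> bool) : nat -> bool :=
  fun j => nth false (f (mkseq u j.+1)) j.

(** [Negz j] is the position -(j+1): the letter there is the one of index [j],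
    read from right to left, in the image of u_{-(j+1)} ... u_{-1}. *)
Definition morph_int (f : seq bool -> seq bool) (u : int -> bool) : int -> bool :=
  fun z => match z with
  | Posz j => morph_nat f (fun i => u (Posz i)) j
  | Negz j => nth false (rev (f (rev (mkseq (fun i => u (Negz i)) j.+1)))) j
  end.

(** In [digit] and [neg_digit] the index [i] starts at 1, as in y_1 y_2 y_3 ...
    Below, the digit condition does not depend on the admissible exponent [k]. *)

Definition T_pos {R : realType} (beta x : R) : R :=
  beta * x - (Num.floor (beta * x))%:~R.

Definition digit {R : realType} (beta x : R) (i : nat) : int :=
  Num.floor (beta * iter i.-1 (T_pos beta) x).

Definition Zbeta_plus {R : realType} (beta : R) : set R :=
  [set x | 0 <= x /\
    exists k : nat, 0 <= x / beta ^+ k < 1 /\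
      forall i : nat, (k < i)%N -> digit beta (x / beta ^+ k) i = 0].

Definition Zbeta {R : realType} (beta : R) : set R :=
  Zbeta_plus beta `|` (-%R @` Zbeta_plus beta).

Definition l_neg {R : realType} (beta : R) : R := - (beta / (beta + 1)).

Definition T_neg {R : realType} (beta x : R) : R :=
  - beta * x - (Num.floor (- beta * x - l_neg beta))%:~R.

Definition neg_digit {R : realType} (beta x : R) (i : nat) : int :=
  Num.floor (- beta * iter i.-1 (T_neg beta) x - l_neg beta).

Definition Zneg_beta {R : realType} (beta : R) : set R :=
  [set x | exists k : nat,
    l_neg beta < x / (- beta) ^+ k < l_neg beta + 1 /\
      forall i : nat, (k < i)%N -> neg_digit beta (x / (- beta) ^+ k) i = 0].

Definition enumerates {R : realType} (S : set R) (t : int -> R) : Prop :=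
  [/\ range t = S, t 0 = 0 & forall j : int, t j < t (j + 1)].

(** Such an enumeration is unique when it exists; [xget] picks it. *)
Definition enumeration {R : realType} (S : set R) : int -> R :=
  xget (fun _ => 0) (enumerates S).

Definition coding_word {R : realType} (S : set R) (Delta : bool -> R) :
    int -> bool :=
  let t := enumeration S in
  fun j => xget false [set X | t (j + 1) - t j = Delta X].

(** The distances Delta_X^+ and Delta_X^-; the suffixes [_add] and [_sub]
    refer to beta^2 = m beta + n and to beta^2 = m beta - n. *)
Definition Delta_plus_add {R : realType} (n : nat) (beta : R) (X : bool) : R :=
  if X then n%:R / beta else 1.
Definition Delta_plus_sub {R : realType} (n : nat) (beta : R) (X : bool) : R :=
  if X then 1 - n%:R / beta else 1.
Definition Delta_minus_add {R : realType} (n : nat) (beta : R) (X : bool) : R :=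
  if X then 1 + n%:R / beta else 1.
Definition Delta_minus_sub {R : realType} (n : nat) (beta : R) (X : bool) : R :=
  if X then 2 - n%:R / beta else 1.

Definition nonneg_part (u : int -> bool) : nat -> bool := fun j => u (Posz j).

Definition u_beta_add {R : realType} (n : nat) (beta : R) : nat -> bool :=
  nonneg_part (coding_word (Zbeta beta) (Delta_plus_add n beta)).
Definition u_beta_sub {R : realType} (n : nat) (beta : R) : nat -> bool :=
  nonneg_part (coding_word (Zbeta beta) (Delta_plus_sub n beta)).
Definition u_neg_beta_add {R : realType} (n : nat) (beta : R) : int -> bool :=
  coding_word (Zneg_beta beta) (Delta_minus_add n beta).
Definition u_neg_beta_sub {R : realType} (n : nat) (beta : R) : int -> bool :=
  coding_word (Zneg_beta beta) (Delta_minus_sub n beta).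

(* Main.v *)
(** Both words are limits of substitutions. Write [D] for the lengths of the two
    letters. If [P] is the substitution 0 -> 0^m 1, 1 -> 0^n (resp.
    0 -> 0^(m-1) 1, 1 -> 0^(m-n-1) 1), then multiplying the tiling coded by the
    fixed point of [P] by [beta] and subdividing each tile according to [P]
    gives the tiling back; following a point through [T_pos] shows that the
    vertices of this tiling are the nonnegative beta-integers. For -beta
    multiplication reverses orientation, so that the tiling of Z_{-beta} is fixed
    by an antimorphism w -> psi(mirror w), with psi: 0 -> 0^(m-1) 1,
    1 -> 0^(m+n-1) 1 (resp. 0 -> 0^(m-2) 1, 1 -> 0^(m-2) 1 0^(m-n-2) 1).
    Splitting the long letter turns this antimorphism into w -> P'(mirror w),
    where P' is [P] or satisfies 0 P'(w) = P(w) 0. The language of [P] is closed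
    under P', under the mirror of [P], hence under reversal and under
    w -> P'(mirror w); conversely the square of w -> P'(mirror w) differs from
    that of [P] by conjugation with a fixed word, so the languages coincide. *)

Require Import Defs.
From mathcomp Require Import all_boot all_order all_algebra.
From mathcomp Require Import all_classical all_reals.
From mathcomp Require Import zify ring lra.
Import Order.TTheory GRing.Theory Num.Theory.
Local Open Scope ring_scope.

(** * Limits of prefixes and factors of infinite words *)

Section Words.
Implicit Types (s : bool -> seq bool) (v w x y : seq bool).

Lemma morphism_cat s v w : morphism s (v ++ w) = morphism s v ++ morphism s w.
Proof. by rewrite /morphism map_cat flatten_cat. Qed.

Lemma morphism1 s a : morphism s [:: a] = s a.
Proof. by rewrite /morphism /= cats0. Qed.

Lemma morphism_cons s a w : morphism s (a :: w) = s a ++ morphism s w.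
Proof. by []. Qed.

Lemma morphism_comp s t w :
  morphism s (morphism t w) = morphism (fun a => morphism s (t a)) w.
Proof. by elim: w => //= a w IH; rewrite !morphism_cons morphism_cat IH. Qed.

Lemma eq_morphism s t : s =1 t -> morphism s =1 morphism t.
Proof. by move=> st w; rewrite /morphism (eq_map st). Qed.

Lemma rev_morphism s w :
  rev (morphism s w) = morphism (fun a => rev (s a)) (rev w).
Proof.
elim: w => //= a w IH.
by rewrite morphism_cons rev_cat IH rev_cons -cats1 morphism_cat morphism1.
Qed.

Lemma size_morphism s w : (forall a, 0 < size (s a))%N ->
  (size w <= size (morphism s w))%N.
Proof.
move=> s0; elim: w => //= a w IH; rewrite morphism_cons size_cat.
by have := s0 a; lia.
Qed.

Lemma size_morphism2 s w : (forall a, 1 < size (s a))%N ->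
  ((size w).*2 <= size (morphism s w))%N.
Proof.
move=> s0; elim: w => //= a w IH; rewrite morphism_cons size_cat.
by have := s0 a; lia.
Qed.

Lemma morphism_nseq1 s k a : s a = [:: a] -> morphism s (nseq k a) = nseq k a.
Proof. by move=> sa; elim: k => //= k IH; rewrite morphism_cons sa IH. Qed.

(** The length bound makes the prefixes [c k] exhaust [z], so [c] determines [z]. *)
Definition is_limit (c : nat -> seq bool) (z : nat -> bool) :=
  forall k, (k <= size (c k))%N /\ c k = mkseq z (size (c k)).

Lemma limit_exists (c : nat -> seq bool) :
  (forall k, prefix (c k) (c k.+1)) -> (forall k, (k <= size (c k))%N) ->
  exists z, is_limit c z.
Proof.
move=> cp cs; exists (fun j => nth false (c j.+1) j) => k; split=> //.
have mono i d : prefix (c i) (c (i + d)%N).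
  elim: d => [|d IH]; first by rewrite addn0 prefix_refl.
  by rewrite addnS; apply: prefix_trans IH (cp _).
apply: (@eq_from_nth _ false); first by rewrite size_mkseq.
move=> i ilt; rewrite nth_mkseq//.
have := cs i.+1; case: (leqP k i.+1) => [ki|ki] isz.
  have /prefixP[q E] := mono k (i.+1 - k)%N.
  by rewrite subnKC// in E; rewrite E nth_cat ilt.
have /prefixP[q E] := mono i.+1 (k - i.+1)%N.
by rewrite subnKC 1?ltnW// in E; rewrite E nth_cat isz.
Qed.

Lemma mkseq_take (z : nat -> bool) i j : (i <= j)%N ->
  take i (mkseq z j) = mkseq z i.
Proof. by move=> ij; rewrite /mkseq -map_take take_iota (minn_idPl ij). Qed.

Lemma limit_nth c z k i : is_limit c z -> (i < size (c k))%N ->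
  nth false (c k) i = z i.
Proof. by move=> /(_ k)[_ E] ilt; rewrite E nth_mkseq. Qed.

Lemma limit_split c z k v a w : is_limit c z -> c k = v ++ a :: w ->
  v = mkseq z (size v) /\ a = z (size v).
Proof.
move=> L E; have sk : size (c k) = (size v + (size w).+1)%N.
  by rewrite E size_cat.
split.
  have <- : take (size v) (c k) = v by rewrite E take_size_cat.
  have [_ ->] := L k; rewrite mkseq_take ?size_mkseq//; last lia.
by rewrite -(limit_nth _ _ k _ L) ?sk; [rewrite E nth_cat ltnn subnn|lia].
Qed.

Lemma limit_splitV c z i : is_limit c z ->
  exists k w, c k = mkseq z i ++ z i :: w.
Proof.
move=> L; exists i.+1, (drop i.+1 (c i.+1)).
have [sz E] := L i.+1.
by rewrite -cat_rcons -mkseqS -[LHS](cat_take_drop i.+1) {1}E mkseq_take.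
Qed.

Lemma limit_uniq c z c' z' (e : nat -> nat) : is_limit c z -> is_limit c' z' ->
  (forall k, k <= e k)%N -> (forall k, c (e k) = c' (e k)) -> z = z'.
Proof.
move=> L L' ek E; apply: funext => i.
have lt : (i < size (c (e i.+1)))%N by have [+ _] := L (e i.+1); have := ek i.+1; lia.
by rewrite -(limit_nth _ _ _ _ L lt) E (limit_nth _ _ _ _ L')// -E.
Qed.

(** [f] is kept abstract because the left half of a bidirectional word needs a morphism conjugated
    by [rev]. *)
Lemma limit_morph f c z :
  (forall v w, f (v ++ w) = f v ++ f w) -> (forall w, size w <= size (f w))%N ->
  is_limit c z -> is_limit (f \o c) (morph_nat f z).
Proof.
move=> fM fs L k /=; have [sk Ek] := L k; split.
  exact: leq_trans sk (fs _).
apply: (@eq_from_nth _ false); first by rewrite size_mkseq.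
move=> i ilt; rewrite nth_mkseq// /morph_nat.
have isz : (i < size (f (mkseq z i.+1)))%N.
  by apply: leq_trans (fs _); rewrite size_mkseq.
(* Images of nested prefixes are nested, so both carry the same letter at position [i]. *)
have mono a b : (a <= b)%N -> exists q, f (mkseq z b) = f (mkseq z a) ++ q.
  move=> ab; exists (f (drop a (mkseq z b))); rewrite -fM.
  by rewrite -{1}(mkseq_take z _ _ ab) cat_take_drop.
rewrite Ek; rewrite Ek in ilt.
case: (leqP (size (c k)) i.+1) => [h|/ltnW h]; have [q E] := mono _ _ h.
  by rewrite E nth_cat ilt.
by rewrite E nth_cat isz.
Qed.

Lemma infix_split (v w : seq bool) : infix v w -> exists x y, w = x ++ v ++ y.
Proof. by move=> /infixP. Qed.

Lemma language_natP c z w : is_limit c z ->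
  language_nat z w <-> exists k, infix w (c k).
Proof.
move=> L; split=> [[i E]|[k /infix_split[p [q E]]]].
  exists (i + size w)%N; apply/infixP.
  exists (mkseq z i), (drop (i + size w) (c (i + size w)%N)).
  have [sz Ek] := L (i + size w)%N.
  rewrite catA -[LHS](cat_take_drop (i + size w)); congr (_ ++ _).
  rewrite {1}Ek mkseq_take// /mkseq iotaD map_cat; congr (_ ++ _).
  by rewrite [RHS]E /mkseq add0n -[X in iota X _]addn0 iotaDl -map_comp.
exists (size p); apply: (@eq_from_nth _ false); first by rewrite size_mkseq.
move=> i ilt; rewrite nth_mkseq// -(limit_nth _ _ k _ L); last first.
  by rewrite E !size_cat; lia.
rewrite E; by rewrite nth_cat ltnNge leq_addr/= addKn nth_cat ilt.
Qed.

Lemma language_intP c d (z : int -> bool) w :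
  is_limit c (fun i => z (Negz i)) -> is_limit d (fun i => z (Posz i)) ->
  language_int z w <-> exists k, infix w (rev (c k) ++ d k).
Proof.
move=> Lc Ld.
(* Position 0 has index [size (c k)] in the window [rev (c k) ++ d k]. *)
have nthE k (i : int) : - (size (c k))%:Z <= i -> i < (size (d k))%:Z ->
    nth false (rev (c k) ++ d k) (absz (i + (size (c k))%:Z)) = z i.
  move=> h1 h2; rewrite nth_cat size_rev.
  case: i h1 h2 => i h1 h2.
    rewrite ifF; last by lia.
    by rewrite -(limit_nth _ _ k i Ld); [congr nth; lia|lia].
  have ic : (i < size (c k))%N by lia.
  rewrite ifT; last by lia.
  rewrite nth_rev; last by lia.
  by rewrite -(limit_nth _ _ k i Lc)//; congr nth; lia.
split=> [[i E]|[k /infix_split[p [q E]]]].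
  (* The window for this [k] covers all [size w] positions from [i] on. *)
  pose k := (absz i + size w)%N; exists k.
  have [sc _] := Lc k; have [sd _] := Ld k.
  pose a := (absz (i + (size (c k))%:Z)).
  have sz : size (rev (c k) ++ d k) = (size (c k) + size (d k))%N.
    by rewrite size_cat size_rev.
  apply/infixP; exists (take a (rev (c k) ++ d k)).
  exists (drop (size w) (drop a (rev (c k) ++ d k))).
  rewrite -{1}(cat_take_drop a (rev _ ++ _)); congr (_ ++ _).
  rewrite -{1}(cat_take_drop (size w) (drop _ _)); congr (_ ++ _).
  have szt : size (take (size w) (drop a (rev (c k) ++ d k))) = size w.
    by rewrite size_takel// size_drop sz /a; lia.
  apply: (@eq_from_nth _ false) => // j; rewrite szt => jlt.
  rewrite nth_take// nth_drop E nth_mkseq// -(nthE k); try lia.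
  by congr nth; lia.
exists ((size p)%:Z - (size (c k))%:Z).
have sz : (size (c k) + size (d k) = size p + size w + size q)%N.
  by have := congr1 size E; rewrite !size_cat size_rev; lia.
apply: (@eq_from_nth _ false); first by rewrite size_mkseq.
move=> i ilt; rewrite nth_mkseq// -(nthE k); try lia.
rewrite E; set a := absz _; have -> : a = (size p + i)%N by rewrite /a; lia.
by rewrite nth_cat ltnNge leq_addr/= addKn nth_cat ilt.
Qed.

End Words.

(** * Languages generated by morphisms and antimorphisms *)

Section FactorLanguages.
Implicit Types (B f : seq bool -> seq bool) (s v w x y z : seq bool).

Definition cat_morph B :=
  (forall x y, B (x ++ y) = B x ++ B y) \/ (forall x y, B (x ++ y) = B y ++ B x).

Definition factor_lang B s w := exists k, infix w (iter k B s).

Lemma infix_cat_morph B v w : cat_morph B -> infix v w -> infix (B v) (B w).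
Proof.
move=> BM /infix_split[x [y ->]]; apply/infixP.
by case: BM => BM; rewrite !BM; [exists (B x), (B y)|exists (B y), (B x); rewrite catA].
Qed.

Lemma factor_lang_infix B s v w : infix v w -> factor_lang B s w -> factor_lang B s v.
Proof. by move=> vw [k wk]; exists k; apply: infix_trans wk. Qed.

Lemma factor_lang_mid B s x v y : factor_lang B s (x ++ v ++ y) -> factor_lang B s v.
Proof. by apply: factor_lang_infix; apply: infix_infix. Qed.

Lemma factor_lang_closed B s v : cat_morph B -> factor_lang B s v ->
  factor_lang B s (B v).
Proof. by move=> BM [k vk]; exists k.+1; rewrite iterS infix_cat_morph. Qed.

(** By closure every iterate of [B] on [s] lies in the other language, and with it all its factors.
    All inclusions of languages below use this. *)
Lemma factor_lang_sub B s B' s' : cat_morph B ->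
  factor_lang B' s' s -> (forall v, factor_lang B' s' v -> factor_lang B' s' (B v)) ->
  forall w, factor_lang B s w -> factor_lang B' s' w.
Proof.
move=> BM s0 cl w [k wk]; apply: factor_lang_infix wk _.
by elim: k => //= k IH; apply: cl.
Qed.

(** If the seed is interior to its image, each iterate is interior to the next. The letters 0 on
    both sides later absorb conjugating words. *)
Lemma factor_lang_ext B s z1 z2 : cat_morph B ->
  (forall v, false \in v -> false \in B v) ->
  B s = z1 ++ s ++ z2 -> false \in z1 -> false \in z2 ->
  forall v, factor_lang B s v ->
  exists x y, [/\ factor_lang B s (x ++ v ++ y), false \in x & false \in y].
Proof.
move=> BM B0 Bs z10 z20 v [k vk].
have {vk}[x' [y' E]] := infix_split _ _ vk.
have [x [y [Ek x0 y0]]] : exists x y,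
    [/\ iter k.+1 B s = x ++ iter k B s ++ y, false \in x & false \in y].
  elim: k {E} => [|k [x [y [E x0 y0]]]]; first by exists z1, z2.
  rewrite 2!iterS -[B (iter k B s)]iterS {1}E iterS; set t := iter k B s.
  case: BM => BM; rewrite !BM; first by exists (B x), (B y); split; auto.
  by exists (B y), (B x); split; auto; rewrite catA.
exists (x ++ x'), (y' ++ y); split; rewrite ?mem_cat ?x0 ?y0 ?orbT//.
by exists k.+1; rewrite Ek E !catA infix_refl.
Qed.

Lemma iter_conj f B B' s k : (forall v, f (B v) = B' (f v)) ->
  f (iter k B s) = iter k B' (f s).
Proof. by move=> fB; elim: k => //= k IH; rewrite fB IH. Qed.

(** As the seed is a prefix of its image, the iterates form a chain of prefixes, and every second
    one suffices. *)
Lemma factor_lang_double B s : (forall x y, B (x ++ y) = B x ++ B y) ->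
  prefix s (B s) -> forall w, factor_lang B s w <-> factor_lang (B \o B) s w.
Proof.
move=> BM sB w; have iterE k : iter k (B \o B) s = iter (k + k) B s.
  by elim: k => //= k ->; rewrite addnS.
split=> -[k wk]; last by exists (k + k)%N; rewrite -iterE.
exists k; rewrite iterE; apply: infix_trans wk _; apply: prefixW.
have mono j i : prefix (iter i B s) (iter (j + i) B s).
  elim: j => [|j IH]; first exact: prefix_refl.
  rewrite addSn; apply: prefix_trans IH _; elim: (j + i)%N => //= l /prefixP[q {2}->].
  by rewrite BM prefix_prefix.
exact: mono.
Qed.

Lemma cat_morph_comp B B' : cat_morph B -> cat_morph B' -> cat_morph (B \o B').
Proof. by case=> BM [] BM'; [left|right|right|left] => x y /=; rewrite BM' BM. Qed.

Lemma morphism_cat_morph (P : bool -> seq bool) : cat_morph (morphism P).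
Proof. by left; apply: morphism_cat. Qed.

Lemma morphism_rev_cat_morph (P : bool -> seq bool) :
  cat_morph (fun v => morphism P (rev v)).
Proof. by right => x y; rewrite rev_cat morphism_cat. Qed.

Lemma mem_morphism (P : bool -> seq bool) v :
  false \in P false -> false \in v -> false \in morphism P v.
Proof. by move=> P0 v0; apply/flatten_mapP; exists false. Qed.

(* The mirror images of the iterates of [morphism P] are the iterates of [S]. *)
Lemma factor_lang_rev (P : bool -> seq bool) :
  let S v := rev (morphism P (rev v)) in
  (forall v, factor_lang (morphism P) [:: false] v ->
    factor_lang (morphism P) [:: false] (S v)) ->
  factor_lang (morphism P) [:: false] [:: false] ->
  forall v, factor_lang (morphism P) [:: false] v ->
    factor_lang (morphism P) [:: false] (rev v).
Proof.
move=> S SL L0 v [k vk].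
have : infix (rev v) (rev (iter k (morphism P) [:: false])) by rewrite infix_rev.
move=> /factor_lang_infix; apply; rewrite (iter_conj rev _ S).
  by elim: k {vk} => //= k IH; apply: SL.
by move=> w; rewrite /S revK.
Qed.

End FactorLanguages.

(** * The language of [P] and its antimorphism, case [beta^2 = m beta + n] *)

Section MirrorAdd.
Variables (m n : nat) (P : bool -> seq bool).
Hypotheses (m2 : (1 < m)%N)
  (P0 : P false = rcons (nseq m false) true) (P1 : P true = nseq n false).
Let F := morphism P.
Let S v := rev (F (rev v)).
Let A v := F (rev v).
Let zm := nseq m false.

Let Fc v w : F (v ++ w) = F v ++ F w. Proof. exact: morphism_cat. Qed.

Let rev_zm : rev zm = zm. Proof. exact: rev_nseq. Qed.

(** Conjugation by [0^m]: on the letter 0 both sides are [0^m 1 0^m], on the letter 1 both are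
    [0^(m+n)]. *)
Let F_S v : F v ++ zm = zm ++ S v.
Proof.
elim: v => [|a v IH]; first by rewrite /S /= cats0.
rewrite /S rev_cons -cats1 /F morphism_cat rev_cat morphism1 -/F -/(S v).
rewrite [F (a :: v)]morphism_cons -catA -/F IH !catA; congr (_ ++ _).
case: a; rewrite ?P0 ?P1; last by rewrite rev_rcons rev_zm cat_rcons.
by rewrite rev_nseq /zm -!nseqD addnC.
Qed.

(** Leading letters 1 contribute blocks [0^n], which commute with [0^m]; the first 0 contributes
    [0^m 1]. *)
Let zm_prefix z : false \in z -> exists y, F z = zm ++ y.
Proof.
elim: z => // -[] z IH; last first.
  by move=> _; exists (true :: F z); rewrite /F morphism_cons P0 cat_rcons.
rewrite inE /= => /IH[y Ey]; exists (nseq n false ++ y).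
rewrite [F _]morphism_cons -/F Ey P1 !catA; congr (_ ++ _).
by rewrite /zm -!nseqD addnC.
Qed.

Let zm_suffix z : false \in z -> exists y, S z = y ++ zm.
Proof.
rewrite -mem_rev => /zm_prefix[y E]; exists (rev y).
by rewrite /S E rev_cat rev_zm.
Qed.

Let P00 : false \in P false.
Proof. by rewrite P0 mem_rcons inE; case: m m2. Qed.

Let L := factor_lang F [:: false].

Let Fnn : F [:: false] = false :: false :: nseq m.-2 false ++ [:: true].
Proof. by rewrite /F morphism1 P0; case: m m2 => [|[|k]]//= _; rewrite cats1. Qed.

Let Pl : P false = nseq m.-1 false ++ [:: false; true].
Proof. by rewrite P0 -{1}(prednK (ltnW m2)) -addn1 nseqD -cats1 -catA. Qed.

Let Fl : F [:: false] = nseq m.-1 false ++ [:: false; true].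
Proof. by rewrite /F morphism1 Pl. Qed.

Let L0 : L [:: false]. Proof. by exists 0%N; rewrite infix_refl. Qed.

Let LE w : L w <-> factor_lang (F \o F) [:: false] w.
Proof.
by apply: factor_lang_double; [apply: morphism_cat|rewrite Fnn prefix_prefix].
Qed.

Let L_ext v : L v ->
  exists x y, [/\ L (x ++ v ++ y), false \in x & false \in y].
Proof.
have := Fnn; set r := _ ++ _ => Fr /LE Lv.
(* The seed 0 is only a prefix of [F 0] but interior to [F (F 0)], hence the passage to [F \o F]. *)
have [|||||x [y [Lxy x0 y0]]] := @factor_lang_ext (F \o F) [:: false] [:: false]
  (r ++ F (false :: r)) _ _ _ _ _ v Lv => //;
  last by exists x, y; split=> //; apply/LE.
- by apply: cat_morph_comp; apply: morphism_cat_morph.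
- by move=> w w0; do 2!apply: mem_morphism => //.
- by rewrite /= Fr -cat1s Fc Fr.
by rewrite mem_cat mem_morphism ?orbT// inE.
Qed.

Let L_F v : L v -> L (F v).
Proof. by apply: factor_lang_closed; apply: morphism_cat_morph. Qed.

(** In [F x F v F y] the factor [F y] begins with [0^m], and [F v 0^m = 0^m S v]. *)
Let L_S v : L v -> L (S v).
Proof.
move=> /L_ext[x [y [/L_F + _ /zm_prefix[q E]]]].
rewrite /F !morphism_cat -/F E catA -catA (catA (F v)) F_S -!catA.
by rewrite catA => /factor_lang_mid.
Qed.

Let L_A v : L v -> L (A v).
Proof. by move=> Lv; apply/L_F/(factor_lang_rev P). Qed.

(** The seed [010] is the image under the morphism 1 -> 01 of the two letters [1|0] around the
    delimiter. *)
Lemma mirror_lang_add w :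
  factor_lang F [:: false] w <-> factor_lang A [:: false; true; false] w.
Proof.
set s := [:: false; true; false]; pose M := factor_lang A s.
have AM : cat_morph A by apply: morphism_rev_cat_morph.
split; last first.
  apply: factor_lang_sub => //.
  have : L (F (F [:: false])) by do 2!apply: L_F.
  (* [010] straddles the boundary of the two blocks [F 0] that begin [F (F 0)]. *)
  apply: factor_lang_infix; rewrite Fnn; set r := _ ++ _.
  have -> : F (false :: false :: r) = F [:: false] ++ F [:: false] ++ F r.
    by rewrite -!Fc.
  rewrite {1}Fl Fnn.
  rewrite -!catA; apply/infixP; by exists (nseq m.-1 false), (false :: r ++ F r).
have M_ext v : M v -> exists x y, [/\ M (x ++ v ++ y), false \in x & false \in y].
  (* [A 010 = F 0 F 1 F 0 = 0^(m-1) 010 0^(n+m-1) 1]. *)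
  apply: (@factor_lang_ext A s (nseq m.-1 false)
    (nseq (n + m).-1 false ++ [:: true])) => //.
  - by move=> x x0; apply: mem_morphism => //; rewrite mem_rev.
  - rewrite /A /s /F -[rev _]/[:: false; true; false] !morphism_cons P1 {1}Pl P0.
    rewrite cats0 -catA -cats1 (catA (nseq n _)) -nseqD.
    by have {1}-> : (n + m = (n + m).-1.+1)%N by lia.
  - by case: m m2 => [|[]].
  - by case: m m2 => [|[|k]]// _; rewrite addnS /= mem_cat mem_nseq addnS.
move=> /LE; apply: factor_lang_sub.
- by apply: cat_morph_comp; apply: morphism_cat_morph.
- by exists 0%N.
(* [S x] ends with [0^m], and [0^m S v = F v 0^m] exhibits [F (F v)] inside
   [A (A (x v y)) = F (S (x v y))]. *)
move=> v /M_ext[x [y [Mv /zm_suffix[q E] _]]].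
have /= : M (A (A (x ++ v ++ y))) by do 2!apply: factor_lang_closed => //.
have -> u : A (A u) = F (S u) by [].
have SM a b : S (a ++ b) = S a ++ S b.
  by rewrite /S rev_cat /F morphism_cat rev_cat.
rewrite !SM E -catA (catA zm) -F_S /F !morphism_cat -/F.
by rewrite -!catA => /factor_lang_mid.
Qed.

End MirrorAdd.

(** * The language of [P] and the antimorphism of [Q], case [beta^2 = m beta - n] *)

Section MirrorSub.
Variables (a : bool -> nat) (P Q : bool -> seq bool).
Hypotheses (a0 : (0 < a false)%N)
  (PE : forall X, P X = nseq (a X).+1 false ++ [:: true])
  (QE : forall X, Q X = nseq (a X) false ++ [:: true; false]).
Let F := morphism P.
Let G := morphism Q.
Let S v := rev (F (rev v)).
Let A v := G (rev v).
Let L := factor_lang F [:: false].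

Let Fc v w : F (v ++ w) = F v ++ F w. Proof. exact: morphism_cat. Qed.
Let Gc v w : G (v ++ w) = G v ++ G w. Proof. exact: morphism_cat. Qed.
Let Sc v w : S (v ++ w) = S v ++ S w.
Proof. by rewrite /S rev_cat Fc rev_cat. Qed.

(** Moving one 0 across the word turns each block [0^(a+1) 1] into [0^a 1 0]. *)
Let F_G v : F v ++ [:: false] = false :: G v.
Proof.
elim: v => // X v IH; rewrite -cat1s Fc Gc -catA IH /F /G !morphism1 PE QE.
by rewrite /= -!catA.
Qed.

Let F_S v : true :: F v = S v ++ [:: true].
Proof.
elim: v => // X v IH; rewrite -[X :: v]cat1s Fc Sc -catA -IH /S /F /= !morphism1.
by rewrite PE rev_cat rev_nseq -!catA.
Qed.

Let F_cons v : v != [::] -> exists w, F v = false :: w.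
Proof.
by case: v => // X v _; rewrite -cat1s Fc /F morphism1 PE /=; eexists.
Qed.

Let F_rcons v : v != [::] -> exists w, F v = rcons w true.
Proof.
case/lastP: v => // v X _; rewrite -cats1 Fc {2}/F morphism1 PE catA cats1.
by eexists.
Qed.

Let P00 : false \in P false. Proof. by rewrite PE. Qed.
Let Q00 : false \in Q false. Proof. by rewrite QE mem_cat !inE orbT. Qed.

Let r := nseq (a false).-1 false ++ [:: true].

Let Fr : F [:: false] = false :: false :: r.
Proof. by rewrite /F morphism1 PE /r; case: (a false) a0. Qed.

Let FFr : F (F [:: false]) = F [:: false] ++ F [:: false] ++ F r.
Proof. by rewrite {1}Fr -!Fc. Qed.

Let L0 : L [:: false]. Proof. by exists 0%N; rewrite infix_refl. Qed.

Let LE w : L w <-> factor_lang (F \o F) [:: false] w.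
Proof.
by apply: factor_lang_double; [apply: morphism_cat|rewrite Fr prefix_prefix].
Qed.

Let mem_neq (v : seq bool) : false \in v -> v != [::]. Proof. by case: v. Qed.

Let L_ext v : L v ->
  exists x y, [/\ L (x ++ v ++ y), false \in x & false \in y].
Proof.
move=> /LE Lv.
have [|||||x [y [Lxy x0 y0]]] := @factor_lang_ext (F \o F) [:: false] [:: false]
  (r ++ F [:: false] ++ F r) _ _ _ _ _ v Lv => //;
  last by exists x, y; split=> //; apply/LE.
- by apply: cat_morph_comp; apply: morphism_cat_morph.
- by move=> w w0; do 2!apply: mem_morphism => //.
- by rewrite /= FFr {1}Fr.
by rewrite !mem_cat P00 !orbT.
Qed.

Let L_F v : L v -> L (F v).
Proof. by apply: factor_lang_closed; apply: morphism_cat_morph. Qed.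

(** [F x] ends with 1, and [1 F v = S v 1]. *)
Let L_S v : L v -> L (S v).
Proof.
move=> /L_ext[x [y [/L_F + /mem_neq/F_rcons[q E] _]]].
rewrite !Fc E -cats1 -catA (catA _ (F v)) cat1s F_S -catA.
by move=> /factor_lang_mid.
Qed.

(** [F y] begins with 0, and [F v 0 = 0 G v]. *)
Let L_G v : L v -> L (G v).
Proof.
move=> /L_ext[x [y [/L_F + _ /mem_neq/F_cons[q E]]]].
rewrite !Fc E -(cat1s _ q) (catA (F v)) F_G -cat1s -!catA catA.
by move=> /factor_lang_mid.
Qed.

Let L_A v : L v -> L (A v).
Proof. by move=> Lv; apply/L_G/(factor_lang_rev P). Qed.

Lemma mirror_lang_sub w :
  factor_lang F [:: false] w <-> factor_lang A [:: true; false; false] w.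
Proof.
set s := [:: true; false; false]; pose M := factor_lang A s.
have AM : cat_morph A by apply: morphism_rev_cat_morph.
split; last first.
  apply: factor_lang_sub => //.
  have : L (F (F [:: false])) by do 2!apply: L_F.
  apply: factor_lang_infix; rewrite FFr {1}/F morphism1 PE Fr -!catA; apply/infixP.
  by exists (nseq (a false).+1 false), (r ++ F r).
have M_ext v : M v -> exists x y, [/\ M (x ++ v ++ y), false \in x & false \in y].
  pose z2 := nseq (a false).-1 false ++ [:: true; false] ++ Q true.
  apply: (@factor_lang_ext A s (nseq (a false) false) z2) => //.
  - by move=> x x0; apply: mem_morphism => //; rewrite mem_rev.
  - rewrite /A /s /G -[rev _]/[:: false; false; true] !morphism_cons cats0 !QE.
    by rewrite /z2 QE -!catA; case: (a false) a0.
  - by case: (a false) a0.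
  - by rewrite /z2 !mem_cat !inE !orbT.
move=> /LE; apply: factor_lang_sub.
- by apply: cat_morph_comp; apply: morphism_cat_morph.
- by exists 0%N.
move=> v /M_ext[x [y [Mv _ y0]]].
have /= : M (A (A (x ++ v ++ y))) by do 2!apply: factor_lang_closed => //.
pose S' u := rev (G (rev u)).
have -> u : A (A u) = G (S' u) by [].
have S'c u1 u2 : S' (u1 ++ u2) = S' u1 ++ S' u2.
  by rewrite /S' rev_cat Gc rev_cat.
(* Mirroring [F_G] gives [S' u 0 = 0 S u]; appending 1 and applying [F_S] moves [01] across. *)
have S'S u : S' u ++ [:: false; true] = [:: false; true] ++ F u.
  have := congr1 rev (F_G (rev u)); rewrite rev_cat [RHS]rev_cons -/(S u) -/(S' u) => E.
  by rewrite -(cat1s false [:: true]) catA (cats1 (S' u)) -E -catA -F_S.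
have [q Eq] : exists q, S' y = [:: false; true] ++ q.
  case: y y0 {Mv} => // X y _; rewrite -cat1s S'c /S' /= /G morphism1 QE rev_cat.
  by eexists.
have [t Et] : exists t, G [:: false; true] = t ++ [:: false].
  by rewrite /G morphism_cons morphism1 (QE true) -(cat1s true) !catA; eexists.
(* The [01] beginning [S' y] is moved in front of [F v]; then [G 01] ends with 0, and
   [0 G (F v) = F (F v) 0]. *)
rewrite !S'c Eq (catA (S' v)) S'S !Gc Et -!catA.
rewrite (catA [:: false]) cat1s -F_G -catA.
by rewrite catA; apply: factor_lang_mid.
Qed.

End MirrorSub.

(** * Tilings of the line *)

Section Enumerations.
Variable R : realType.
Implicit Types (D : bool -> R) (z : int -> bool) (t : int -> R) (S : set R).

Definition len D (w : seq bool) : R := \sum_(a <- w) D a.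

Lemma len_cat D v w : len D (v ++ w) = len D v + len D w.
Proof. by rewrite /len big_cat. Qed.

Lemma len_cons D a w : len D (a :: w) = D a + len D w.
Proof. by rewrite /len big_cons. Qed.

Lemma len_nil D : len D [::] = 0. Proof. by rewrite /len big_nil. Qed.

Lemma len_nseq D k a : len D (nseq k a) = k%:R * D a.
Proof.
elim: k => [|k IH]; first by rewrite len_nil mul0r.
by rewrite /= len_cons IH -natr1; ring.
Qed.

Lemma len_rev D w : len D (rev w) = len D w.
Proof. exact: perm_big (permEl (perm_rev w)). Qed.

Lemma len_morphism D (s : bool -> seq bool) (c : R) w :
  (forall a, len D (s a) = c * D a) -> len D (morphism s w) = c * len D w.
Proof.
move=> sD; elim: w => [|a w IH]; first by rewrite len_nil mulr0.
by rewrite morphism_cons len_cat len_cons IH sD mulrDr.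
Qed.

Lemma stepwise_lt t : (forall j, t j < t (j + 1)) ->
  forall i j, (t i < t j) = (i < j).
Proof.
move=> st; have homo i j : i < j -> t i < t j.
  move=> ij; have -> : j = i + (absz (j - i)).-1.+1%:Z by lia.
  elim: (absz _).-1 => [|d IH]; first exact: st.
  by rewrite -addn1 PoszD addrA; apply: lt_trans IH (st _).
move=> i j; apply/idP/idP => [tij|]; last exact: homo.
rewrite ltNge le_eqVlt; apply/negP => /orP[/eqP E|/homo tji].
  by rewrite E ltxx in tij.
by have := lt_trans tij tji; rewrite ltxx.
Qed.

(** The successor of a point in one enumeration is a value of the other, so neither can overshoot;
    the induction runs both ways from 0. *)
Lemma enumerates_uniq S t t' : enumerates S t -> enumerates S t' -> t = t'.
Proof.
have val u v i : enumerates S u -> enumerates S v -> exists j, v j = u i.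
  move=> [ru _ _] [rv _ _]; have : S (u i) by rewrite -ru; exists i.
  by rewrite -rv => -[j _ <-]; exists j.
have up u v i : enumerates S u -> enumerates S v -> u i = v i ->
    v (i + 1) <= u (i + 1).
  move=> Su Sv E; have [j Ej] := val u v (i + 1) Su Sv.
  case: Su Sv => [_ _ su] [_ _ sv]; rewrite leNgt; apply/negP.
  have := su i; rewrite -Ej E !(stepwise_lt _ sv); lia.
have down u v i : enumerates S u -> enumerates S v -> u (i + 1) = v (i + 1) ->
    u i <= v i.
  move=> Su Sv E; have [j Ej] := val u v i Su Sv.
  case: Su Sv => [_ _ su] [_ _ sv]; rewrite leNgt; apply/negP.
  have := su i; rewrite -Ej E !(stepwise_lt _ sv); lia.
move=> St St'; apply: funext => -[]; elim=> [|i IH].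
- by case: St St' => [_ -> _] [_ -> _].
- have -> : Posz i.+1 = Posz i + 1 by lia.
  by apply/eqP; rewrite eq_le !up.
- have E : t 0 = t' 0 by case: St St' => [_ -> _] [_ -> _].
  by apply/eqP; rewrite eq_le !down.
have E1 : Negz i = Negz i.+1 + 1 by lia.
by apply/eqP; rewrite eq_le !down// -E1.
Qed.

(** The vertices of the tiling coded by [z]; [Negz i] is [-(i+1)], hence [i.+1] tiles to the left of
    0. *)
Definition positions D z : int -> R := fun j =>
  match j with
  | Posz i => len D (mkseq (fun k => z (Posz k)) i)
  | Negz i => - len D (mkseq (fun k => z (Negz k)) i.+1)
  end.

Lemma positions_step D z j : positions D z (j + 1) = positions D z j + D (z j).
Proof.
case: j => [i|[|i]].
- by rewrite -PoszD addn1 /= mkseqS -cats1 len_cat len_cons len_nil addr0.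
- by rewrite /= len_cons len_nil addr0 addNr.
have -> : Negz i.+1 + 1 = Negz i by lia.
rewrite /positions [in RHS]mkseqS -cats1 len_cat [len D [:: _]]len_cons len_nil addr0.
by rewrite opprD addrNK.
Qed.

Lemma positions0 D z : positions D z 0 = 0.
Proof. exact: len_nil. Qed.

Lemma positions_lt D z : (forall X, 0 < D X) ->
  forall i j, (positions D z i < positions D z j) = (i < j).
Proof. by move=> D0; apply: stepwise_lt => j; rewrite positions_step ltrDl. Qed.

(** Uniqueness resolves the [xget] in [enumeration]; that in [coding_word] is resolved because [D]
    separates the letters. *)
Lemma coding_wordE D z S : (forall X, 0 < D X) -> D false != D true ->
  range (positions D z) = S -> coding_word S D = z.
Proof.
move=> D0 Dinj rS.
have en : enumerates S (positions D z).
  by split=> // [|j]; rewrite ?positions0// positions_lt//; lia.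
have Et : enumeration S = positions D z.
  rewrite /enumeration; case: xgetP => [t _ St|/(_ _ en)//].
  exact: enumerates_uniq St en.
apply: funext => j; rewrite /coding_word Et; case: xgetP => [X _ /=|/(_ (z j))[]/=].
  rewrite positions_step addrAC subrr add0r.
  by case: (z j) X => -[]// E; move: Dinj; rewrite E eqxx.
by rewrite positions_step addrAC subrr add0r.
Qed.

Definition tile D z p X := exists2 j, positions D z j = p & z j = X.

Lemma tile_between D z p X y : (forall a, 0 < D a) -> tile D z p X ->
  range (positions D z) y -> p <= y <= p + D X -> y = p \/ y = p + D X.
Proof.
move=> D0 [j <- <-] [i _ <-]; rewrite -positions_step !leNgt !positions_lt//.
move=> h; have [->|->] : i = j \/ i = j + 1 by lia.
  by left.
by right.
Qed.

Lemma tile_right D z p X : tile D z p X -> range (positions D z) (p + D X).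
Proof. by case=> j <- <-; rewrite -positions_step; exists (j + 1). Qed.

Lemma tile_left D z p X : tile D z p X -> range (positions D z) p.
Proof. by case=> j <- _; exists j. Qed.

Lemma range_left D z p : range (positions D z) p -> exists X, tile D z p X.
Proof. by case=> j _ <-; exists (z j), j. Qed.

Lemma range_right D z p : range (positions D z) p ->
  exists q X, tile D z q X /\ p = q + D X.
Proof.
case=> j _ <-; exists (positions D z (j - 1)), (z (j - 1)); split.
  by exists (j - 1).
by rewrite -positions_step subrK.
Qed.

End Enumerations.
Arguments len {R} D w.
Arguments positions {R} D z.
Arguments tile {R} D z p X.

(** * The beta-integers *)

Section PositiveBase.
Variable R : realType.
Implicit Types (beta x v : R).

Lemma expr_unbounded beta (C : R) : 1 < beta -> exists k, C < beta ^+ k.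
Proof.
move=> b1; have bern k : 1 + k%:R * (beta - 1) <= beta ^+ k.
  elim: k => [|k IH]; first by rewrite mul0r addr0.
  rewrite exprS -natr1; have : 0 <= k%:R * (beta - 1) ^+ 2 by rewrite mulr_ge0// sqr_ge0.
  have : beta * (1 + k%:R * (beta - 1)) <= beta * beta ^+ k by rewrite ler_pM2l//; lra.
  by rewrite expr2; lra.
have [k hk] : exists k : nat, C / (beta - 1) < k%:R.
  by exists (Num.truncn (C / (beta - 1))).+1; apply: truncnS_gt.
exists k; apply: lt_le_trans (bern k).
by move: hk; rewrite ltr_pdivrMr ?subr_gt0// => hk; lra.
Qed.

Lemma bounded_orbit0 beta (c : R) : 1 < beta ->
  (forall j, `|c| * beta ^+ j < 1) -> c = 0.
Proof.
move=> b1 H; apply/eqP; rewrite -normr_eq0; apply/negPn/negP => c0.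
have [k] := expr_unbounded beta `|c|^-1 b1.
have c1 : 0 < `|c| by rewrite lt_def c0 normr_ge0.
by have := H k; rewrite -ltr_pdivlMl// mulr1 => /lt_trans h /h; rewrite ltxx.
Qed.

Lemma T_pos_itv beta x : 0 <= T_pos beta x < 1.
Proof.
rewrite /T_pos; have := floor_le (beta * x); have := floorD1_gt (beta * x).
by rewrite intrD; lra.
Qed.

(** While the digits vanish, [T_pos] is multiplication by [beta]; a bounded orbit then forces the
    remainder to be 0. *)
Lemma digit_pos0 beta v k : 1 < beta -> 0 <= v < 1 ->
  (forall i, (k < i)%N -> digit beta v i = 0) <-> iter k (T_pos beta) v = 0.
Proof.
move=> b1 v01.
have itv j : 0 <= iter j (T_pos beta) v < 1.
  by case: j => // j; apply: T_pos_itv.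
split=> [dig|E [|i]//]; last first.
  rewrite ltnS /digit /= => ki; rewrite -(subnK ki) iterD E.
  have -> : iter (i - k) (T_pos beta) 0 = 0.
    by elim: (i - k)%N => //= j ->; rewrite /T_pos mulr0 floor0 subr0.
  by rewrite mulr0 floor0.
apply: (@bounded_orbit0 beta) => // j.
have -> : `|iter k (T_pos beta) v| * beta ^+ j = iter (j + k) (T_pos beta) v.
  rewrite ger0_norm; last by case/andP: (itv k).
  elim: j => [|j IH]; first by rewrite mulr1.
  rewrite addSn iterS -IH [RHS]/T_pos.
  have := dig (j + k).+1; rewrite /digit /= -IH => -> //; last by lia.
  by rewrite exprS; ring.
by case/andP: (itv (j + k)%N).
Qed.

(** Tile [X] enlarged by [beta] splits into [a X] unit tiles and a last tile [b X]. *)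
Variables (beta : R) (D : bool -> R) (a : bool -> nat) (b : bool -> bool).
Variables (P : bool -> seq bool) (u : nat -> bool).
Hypotheses (b1 : 1 < beta) (D0 : D false = 1) (Dgt0 : forall X, 0 < D X)
  (Dle1 : forall X, D X <= 1) (PE : forall X, P X = rcons (nseq (a X) false) (b X))
  (DE : forall X, beta * D X = (a X)%:R + D (b X))
  (Lu : is_limit (fun k => iter k (morphism P) [:: false]) u).

Let b0 : 0 < beta. Proof. exact: lt_trans b1. Qed.

Let pos j := len D (mkseq u j).
Let ptile p X := exists2 j, pos j = p & u j = X.
(** [Zbeta] is symmetric about 0, so its left half is coded by [u] read leftwards. *)
Definition mirrored : int -> bool :=
  fun j => match j with Posz i => u i | Negz i => u i end.

Let len_P X : len D (P X) = beta * D X.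
Proof. by rewrite PE -cats1 len_cat len_nseq len_cons len_nil DE D0; ring. Qed.

Let ptile_image p X w1 Y w2 : ptile p X -> P X = w1 ++ Y :: w2 ->
  ptile (beta * p + len D w1) Y.
Proof.
move=> [j <- uX] PX; have [k [w E]] := limit_splitV _ _ j Lu.
have Ek : iter k.+1 (morphism P) [:: false] =
    (morphism P (mkseq u j) ++ w1) ++ Y :: w2 ++ morphism P w.
  by rewrite iterS E morphism_cat morphism_cons uX PX -!catA.
have [E1 E2] := limit_split _ _ k.+1 _ _ _ Lu Ek.
exists (size (morphism P (mkseq u j) ++ w1)) => //.
by rewrite /pos -E1 len_cat (len_morphism _ _ _ beta).
Qed.

Let orbit v k : 0 <= v < 1 -> exists p X,
  [/\ ptile p X, v * beta ^+ k = p + iter k (T_pos beta) v &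
      0 <= iter k (T_pos beta) v < D X].
Proof.
move=> v01; elim: k => [|k [p [X [tX E /andP[t0 t1]]]]].
  exists 0, (u 0%N); split; first by exists 0%N => //; apply: len_nil.
    by rewrite mulr1 add0r.
  suff -> : u 0%N = false by rewrite D0.
  by rewrite -(limit_nth _ _ 0 0 Lu).
set t := iter k _ v in E t0 t1; rewrite iterS -/t.
have bt : 0 <= beta * t < (a X)%:R + D (b X).
  by rewrite -DE mulr_ge0 ?(ltW b0)//= ltr_pM2l.
have [d dE] : exists d : nat, Num.floor (beta * t) = d%:Z.
  exists (absz (Num.floor (beta * t))); rewrite gez0_abs// floor_ge0.
  by case/andP: bt.
have := T_pos_itv beta t; rewrite /T_pos dE => td.
have Tt : v * beta ^+ k.+1 = beta * p + d%:R + (beta * t - d%:R).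
  by rewrite exprS mulrCA E; ring.
case: (ltnP d (a X)) => da.
  exists (beta * p + d%:R), false; split=> //; last by rewrite D0.
  have := ptile_image p X (nseq d false) false (rcons (nseq (a X - d).-1 false) (b X)) tX.
  rewrite len_nseq D0 mulr1; apply; rewrite PE -!cats1.
  have {1}-> : (a X = d + (a X - d).-1.+1)%N by lia.
  by rewrite nseqD -catA.
(* Larger digits are excluded by [D (b X) <= 1]; the digit [a X] selects the last subtile. *)
have {}da : d = a X.
  apply/eqP; rewrite eqn_leq da andbT -ltnS -(ltr_nat R).
  by have := Dle1 (b X); rewrite -natr1; lra.
exists (beta * p + d%:R), (b X); split=> //; last by rewrite da in td *; lra.
have := ptile_image p X (nseq d false) (b X) [::] tX.
by rewrite len_nseq D0 mulr1; apply; rewrite PE -cats1 da.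
Qed.

Lemma Zbeta_plus_positions : Zbeta_plus beta = range (fun j : nat => len D (mkseq u j)).
Proof.
have bk k : 0 < beta ^+ k by apply: exprn_gt0.
apply/seteqP; split=> [x [x0 [k [v01 /(digit_pos0 _ _ _ b1 v01) E]]]|x [j _ <-]].
  have [p [X [[j pj _] + _]]] := orbit _ k v01.
  by rewrite E addr0 divfK ?gt_eqF// => ->; exists j.
have x0 : 0 <= len D (mkseq u j) by apply: sumr_ge0 => X _; apply: ltW.
split=> //; have [k hk] := expr_unbounded beta (len D (mkseq u j)) b1.
have v01 : 0 <= len D (mkseq u j) / beta ^+ k < 1.
  apply/andP; split; last by rewrite ltr_pdivrMr// mul1r.
  by rewrite divr_ge0// ltW.
exists k; split=> //; apply/digit_pos0 => //.
have [p [X [[i pi ui] + t01]]] := orbit _ k v01.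
rewrite divfK ?gt_eqF//; set t := iter k _ _ in t01 * => E.
(* A vertex lying in a half-open tile is its left end, so the offset is 0. *)
have [] := @tile_between R D mirrored p X (len D (mkseq u j)) Dgt0.
- by exists (Posz i).
- by exists (Posz j).
- by rewrite E lerDl lerD2l; case/andP: t01 => -> /ltW ->.
- by rewrite E => /eqP; rewrite -subr_eq0 addrC addKr => /eqP.
by rewrite E => /addrI Et; move: t01; rewrite Et ltxx andbF.
Qed.

Lemma coding_word_Zbeta : D false != D true ->
  nonneg_part (coding_word (Zbeta beta) D) = u.
Proof.
move=> Dinj; rewrite (@coding_wordE R D mirrored)// /Zbeta Zbeta_plus_positions.
apply/seteqP; split=> [x [[j|j] _ <-]|x [[j _ <-]|[_ [[|j] _ <-] <-]]].
- by left; exists j.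
- by right; exists (len D (mkseq u j.+1)) => //; exists j.+1.
- by exists (Posz j).
- by exists 0 => //; rewrite positions0 len_nil oppr0.
by exists (Negz j).
Qed.

End PositiveBase.

(** * The (-beta)-integers *)

Section NegativeChain.
Variable psi : bool -> seq bool.
Hypotheses (psi_false : exists w, psi false = rcons w true)
  (psi_true : exists w, psi true = false :: w)
  (psi_size : forall X, (1 < size (psi X))%N).

(** The images of the two halves of the word [1|0] under the iterates of the
    antimorphism [fun w => morphism psi (rev w)]. *)
Definition neg_chain (k : nat) : seq bool * seq bool :=
  iter k (fun p => (morphism psi (rev p.2), morphism psi (rev p.1)))
    ([:: true], [:: false]).

Lemma neg_chainS k : neg_chain k.+1 =
  (morphism psi (rev (neg_chain k).2), morphism psi (rev (neg_chain k).1)).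
Proof. by []. Qed.

Lemma neg_chain_cat k : (neg_chain k).1 ++ (neg_chain k).2 =
  iter k (fun w => morphism psi (rev w)) [:: true; false].
Proof. by elim: k => //= k <-; rewrite rev_cat morphism_cat. Qed.

(** At the start, [psi 0] ends with 1 and [psi 1] begins with 0. Each step exchanges the halves, so
    nesting on one side yields nesting on the other. *)
Lemma neg_chain_limits : exists z : int -> bool,
  is_limit (fun k => rev (neg_chain k).1) (fun i => z (Negz i)) /\
  is_limit (fun k => (neg_chain k).2) (fun i => z (Posz i)).
Proof.
have step k : prefix (rev (neg_chain k).1) (rev (neg_chain k.+1).1) &&
    prefix (neg_chain k).2 (neg_chain k.+1).2.
  elim: k => [|k].
    rewrite /= !morphism1.
    have [w ->] := psi_false; have [w' ->] := psi_true.
    by rewrite rev_rcons /= !prefix0s.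
  move=> /andP[/prefixP[x Ex] /prefixP[y Ey]].
  have El : (neg_chain k.+1).1 = rev x ++ (neg_chain k).1.
    by rewrite -[LHS]revK Ex rev_cat revK.
  have E := neg_chainS k.+1; rewrite El Ey in E; rewrite E neg_chainS.
  rewrite [(_, _).1]/= [(_, _).2]/= ![(_, _).1]/=.
  by rewrite !rev_cat !morphism_cat rev_cat revK !prefix_prefix.
have sz k : (k < size (neg_chain k).1)%N && (k < size (neg_chain k).2)%N.
  elim: k => //= k /andP[s1 s2].
  have := size_morphism2 _ (rev (neg_chain k).1) psi_size.
  by have := size_morphism2 _ (rev (neg_chain k).2) psi_size; rewrite !size_rev; lia.
have [||x Lx] := limit_exists (fun k => rev (neg_chain k).1).
- by move=> k; case/andP: (step k).
- by move=> k; rewrite size_rev ltnW//; case/andP: (sz k).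
have [||y Ly] := limit_exists (fun k => (neg_chain k).2).
- by move=> k; case/andP: (step k).
- by move=> k; rewrite ltnW//; case/andP: (sz k).
by exists (fun j => match j with Posz i => y i | Negz i => x i end).
Qed.

End NegativeChain.

Section NegativeBase.
Variable R : realType.
Implicit Types (beta x v : R).

Lemma l_neg_eq beta : 1 < beta -> beta * l_neg beta + l_neg beta = - beta.
Proof. by move=> b1; rewrite /l_neg; field; lra. Qed.

Lemma l_neg_itv beta : 1 < beta -> - 1 < l_neg beta < - (1/2).
Proof.
move=> b1; have b0 : 0 < beta + 1 by lra.
apply/andP; split; rewrite /l_neg ltrN2; first by rewrite ltr_pdivrMr//; lra.
by rewrite ltr_pdivlMr//; lra.
Qed.

Lemma T_neg_itv beta x : l_neg beta <= T_neg beta x < l_neg beta + 1.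
Proof.
rewrite /T_neg; have := floor_le (- beta * x - l_neg beta).
by have := floorD1_gt (- beta * x - l_neg beta); rewrite intrD; lra.
Qed.

Lemma digit_neg0 beta v k : 1 < beta -> l_neg beta < v < l_neg beta + 1 ->
  (forall i, (k < i)%N -> neg_digit beta v i = 0) <-> iter k (T_neg beta) v = 0.
Proof.
move=> b1 /andP[v0 v1]; have /andP[l1 l0] := l_neg_itv _ b1.
have itv j : l_neg beta <= iter j (T_neg beta) v < l_neg beta + 1.
  by case: j => [|j]; [rewrite ltW|apply: T_neg_itv].
have fl0 : Num.floor (- beta * 0 - l_neg beta) = 0.
  by apply/eqP; rewrite mulr0 sub0r -[_ == _]/(_ == _) floor_eq add0r; lra.
split=> [dig|E [|i]//]; last first.
  rewrite ltnS /neg_digit /= => ki; rewrite -(subnK ki) iterD E.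
  have -> : iter (i - k) (T_neg beta) 0 = 0.
    by elim: (i - k)%N => //= j ->; rewrite /T_neg fl0 mulr0 subr0.
  exact: fl0.
apply: (@bounded_orbit0 _ beta) => // j.
have -> : `|iter k (T_neg beta) v| * beta ^+ j = `|iter (j + k) (T_neg beta) v|.
  elim: j => [|j IH]; first by rewrite mulr1.
  have dj := dig (j + k).+1 (leq_addl _ _); rewrite /neg_digit /= in dj.
  rewrite addSn iterS [in RHS]/T_neg dj subr0 normrM normrN -IH.
  rewrite (gtr0_norm (lt_trans ltr01 b1)).
  by rewrite exprS; ring.
by rewrite ltr_norml; have := itv (j + k)%N; lra.
Qed.

Variables (beta : R) (D : bool -> R) (psi : bool -> seq bool) (z : int -> bool).
Hypotheses (b1 : 1 < beta) (D0 : D false = 1) (D1 : forall X, 1 <= D X)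
  (psiD : forall X, len D (psi X) = beta * D X)
  (Lneg : is_limit (fun k => rev (neg_chain psi k).1) (fun i => z (Negz i)))
  (Lpos : is_limit (fun k => (neg_chain psi k).2) (fun i => z (Posz i))).

(** Multiplication by [-beta] makes the right end [p + D X] the left end of the image and exchanges
    the two sides of 0. *)
Lemma tile_image p X w1 Y w2 : tile D z p X -> psi X = w1 ++ Y :: w2 ->
  tile D z (- beta * (p + D X) + len D w1) Y.
Proof.
move=> [[i|i] <- zX] E.
  have [k [w Ek]] := limit_splitV _ _ i Lpos.
  set v := mkseq _ _ in Ek.
  have Ek' : rev (neg_chain psi k.+1).1 =
      rev (w2 ++ morphism psi (rev v)) ++ Y :: rev (morphism psi (rev w) ++ w1).
    rewrite neg_chainS Ek [(_, _).1]/= rev_cat rev_cons cat_rcons morphism_cat.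
    rewrite morphism_cons zX E -[in RHS]cat_rcons -rev_cons -rev_cat -!catA.
    by rewrite cat_cons.
  have [E1 E2] := limit_split _ _ k.+1 _ _ _ Lneg Ek'; rewrite size_rev in E1 E2.
  exists (Negz (size (w2 ++ morphism psi (rev v)))) => //.
  rewrite /positions mkseqS -E1 -E2 -cats1 len_cat len_rev len_cat !len_cons len_nil.
  rewrite (len_morphism _ _ _ beta)// len_rev.
  by have := psiD X; rewrite E len_cat len_cons -/v; lra.
have [k [w Ek]] := limit_splitV _ _ i Lneg.
set v := mkseq _ _ in Ek.
have Ek' : (neg_chain psi k.+1).2 =
    (morphism psi v ++ w1) ++ Y :: (w2 ++ morphism psi w).
  by rewrite neg_chainS [(_, _).2]/= Ek morphism_cat morphism_cons zX E -!catA.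
have [E1 E2] := limit_split _ _ k.+1 _ _ _ Lpos Ek'.
exists (Posz (size (morphism psi v ++ w1))) => //.
rewrite /positions -E1 mkseqS -cats1 zX !len_cat (len_morphism _ _ _ beta)//.
by rewrite -/v len_cons len_nil; ring.
Qed.

(* [M] is the largest digit, [e = T(l)], and [n0] is the smallest digit that may
   follow [M] in an admissible string. *)
Variables (M n0 : nat).
Let l := l_neg beta.
Let e : R := - beta * l - M%:R.
Let b0 : 0 < beta. Proof. exact: lt_trans b1. Qed.
Hypotheses (M0 : (0 < M)%N) (n0M : (n0 < M)%N) (e0 : e < 0)
  (en0 : n0%:R + l <= - beta * e)
  (psi_zeros : forall X, exists Y w, psi X = nseq M.-1 false ++ Y :: w)
  (psi_true : exists w, psi true = w ++ nseq (M.-1 - n0) false ++ [:: true] /\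
    len D w = n0%:R + beta * D true - beta).

Let pt := range (positions D z).

(** The image of the tile ending at [p] begins at [-beta p] with [M.-1] unit tiles. *)
Let pt_digit p i : pt p -> (i < M)%N -> pt (- beta * p + i%:R).
Proof.
move=> /range_right[q [X [tX ->]]] iM; have [Y [w E]] := psi_zeros X.
(* For [i = M.-1] the tile reached is [Y], otherwise a unit tile; [head] and [behead] cover both. *)
have := tile_image q X (nseq i false) (head Y (nseq (M.-1 - i) false))
  (behead (nseq (M.-1 - i) false ++ Y :: w)) tX.
rewrite len_nseq D0 mulr1 => H; apply: tile_left (H _).
rewrite E; have {1}-> : (M.-1 = i + (M.-1 - i))%N by lia.
by rewrite nseqD -catA; case: (M.-1 - i)%N.
Qed.

Let pt_last p : pt p ->
  pt (- beta * p + M%:R) \/ tile D z (- beta * p + M.-1%:R) true.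
Proof.
move=> /range_right[q [X [tX ->]]]; have [Y [w E]] := psi_zeros X.
have := tile_image q X _ Y w tX E; rewrite len_nseq D0 mulr1.
case: Y E => E t; [by right|left].
by have := tile_right _ _ _ _ _ t; rewrite D0 -addrA natr1 prednK.
Qed.

(** The word [w] from [psi_true] fills the image of the long tile up to [-beta (p + 1) + n0]; digits
    are counted from the image of [p + 1]. *)
Let inner_image p w1 Y w2 : tile D z p true ->
  nseq (M.-1 - n0) false ++ [:: true] = w1 ++ Y :: w2 ->
  tile D z (- beta * p - beta + n0%:R + len D w1) Y.
Proof.
move=> tp E; have [w [Ew lw]] := psi_true.
have := tile_image p true (w ++ w1) Y w2 tp; rewrite len_cat lw => H.
rewrite (_ : _ + len D w1 = - beta * (p + D true) +
  (n0%:R + beta * D true - beta + len D w1)); last by ring.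
by apply: H; rewrite Ew E catA.
Qed.

Let inner_last p : tile D z p true -> tile D z (- beta * p - beta + M.-1%:R) true.
Proof.
move=> tp; have := inner_image p _ true [::] tp erefl.
by rewrite len_nseq D0 mulr1 -addrA -natrD subnKC//; lia.
Qed.

Let inner_digit p d : tile D z p true -> (n0 <= d < M)%N ->
  pt (- beta * p - beta + d%:R).
Proof.
move=> tp /andP[nd dM]; have [->|dM1] := eqVneq d M.-1.
  by apply: tile_left (inner_last p tp).
have := inner_image p (nseq (d - n0) false) false
  (nseq (M.-1 - d).-1 false ++ [:: true]) tp.
rewrite len_nseq D0 mulr1 -addrA -natrD subnKC// => H; apply: tile_left (H _).
have -> : (M.-1 - n0 = (d - n0) + (M.-1 - d).-1.+1)%N by lia.
by rewrite nseqD -catA.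
Qed.

(* The invariant linking [y = (-beta)^k v] and [t = T^k(v)]: [y - t] is a vertex,
   except for cylinders whose image under [T^k] is cut off at [e]; these do not
   contain 0 in their image and lie inside a long tile. The inequalities are
   closed on both sides, so that the orientation of the half-open cylinders,
   which alternates with [k], plays no role. *)
Let related y t := l <= t < l + 1 /\
  ((exists2 p, pt p & y = p + t) \/
   (exists p, [/\ tile D z p true, y = p + 1 + t & t <= e])).

(** Every digit [i < M] leads to a vertex, while [i = M] may lead into a long tile. *)
Let related_T y t : related y t -> related (- beta * y) (T_neg beta t).
Proof.
have lb : beta * l + l = - beta := l_neg_eq _ b1.
have /andP[l1 l0] : - 1 < l < - (1/2) := l_neg_itv _ b1.
move=> [/andP[tl tr] IH].
have := T_neg_itv beta t; rewrite /T_neg -/l; move: (Num.floor _) => d.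
have [t' tE] : exists t', - beta * t - d%:~R = t' by eexists.
rewrite tE => t'l; split=> //; case/andP: t'l => t'l t'r.
have bt1 : l < - beta * t.
  have : beta * t < beta * (l + 1) by rewrite ltr_pM2l.
  by rewrite mulrDr; lra.
have bt2 : - beta * t <= - beta * l by rewrite !mulNr lerN2 ler_pM2l.
have eE : - beta * l = M%:R + e by rewrite /e; ring.
(* [-beta t <= M + e] with [e < 0] and [t' >= l > -1] leaves [d < M + 1]. *)
have dM : d <= M%:Z.
  by rewrite -ltzD1 -(ltr_int R) intrD -pmulrn; have := e0; lra.
have dge (i : nat) : i%:R + l <= - beta * t -> i%:Z <= d.
  by move=> h; rewrite -ltzD1 -(ltr_int R) intrD -pmulrn; lra.
have [i di] : exists i : nat, d = i by exists (absz d); rewrite gez0_abs ?dge//; lra.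
rewrite {}di -pmulrn in tE dM dge.
have tE' : - beta * t = i%:R + t' by rewrite -tE; ring.
have iM : (i <= M)%N by [].
case: IH => [[p ptp ->]|[p [tp -> te]]].
  have [iltM|] := ltnP i M.
    by left; exists (- beta * p + i%:R); [apply: pt_digit|rewrite mulrDr tE' addrA].
  move=> Mi; have {iM Mi}iE : i = M by apply/eqP; rewrite eqn_leq iM.
  rewrite iE in tE'; have [H|H] := pt_last p ptp.
    by left; exists (- beta * p + M%:R) => //; rewrite mulrDr tE' addrA.
  right; exists (- beta * p + M.-1%:R); split=> //; last by lra.
  by rewrite mulrDr tE' -[in M%:R](prednK M0) -natr1; ring.
have bte : - beta * e <= - beta * t by rewrite !mulNr lerN2 ler_pM2l.
(* [t <= e] gives [-beta t >= -beta e >= n0 + l]. *)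
have ni : (n0 <= i)%N by rewrite -lez_nat; apply: dge; apply: le_trans en0 bte.
have [iltM|Mi] := ltnP i M.
  left; exists (- beta * p - beta + i%:R); first by apply: inner_digit; rewrite ?ni.
  by rewrite !mulrDr mulr1 tE' addrA.
have {iM Mi}iE : i = M by apply/eqP; rewrite eqn_leq iM.
rewrite iE in tE'; right; exists (- beta * p - beta + M.-1%:R); split.
- exact: inner_last.
- by rewrite !mulrDr mulr1 tE' -[in M%:R](prednK M0) -natr1; ring.
lra.
Qed.

Let orbit v k : l <= v < l + 1 ->
  related (v * (- beta) ^+ k) (iter k (T_neg beta) v).
Proof.
move=> vl; elim: k => [|k /related_T]; last by rewrite exprS mulrCA.
split=> //; left; exists 0; last by rewrite mulr1 add0r.
by exists 0 => //; apply: positions0.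
Qed.

(** [|t| < 1] while tiles have length at least 1; in the second case [p + 1 + t] is strictly inside
    the long tile. *)
Let related0 y t : related y t -> pt y -> t = 0.
Proof.
have /andP[l1 l0] : - 1 < l < - (1/2) := l_neg_itv _ b1.
have Dgt0 X : 0 < D X by have := D1 X; lra.
move=> [/andP[tl tr] [[p ptp E]|[p [tp E te]]]] pty.
  have [t0|t0] := lerP 0 t.
    have [X tX] := range_left _ _ _ _ ptp; have DX := D1 X.
    have [||] := tile_between _ _ _ _ _ _ Dgt0 tX pty; lra.
  have [q [X [tX pE]]] := range_right _ _ _ _ ptp; have DX := D1 X.
  by have [||] := tile_between _ _ _ _ _ _ Dgt0 tX pty; lra.
have e0' := e0; have DX := D1 true.
by have [||] := tile_between _ _ _ _ _ _ Dgt0 tp pty; lra.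
Qed.

Lemma Zneg_beta_positions : Zneg_beta beta = range (positions D z).
Proof.
have lb : beta * l + l = - beta := l_neg_eq _ b1.
have /andP[l1 l0] : - 1 < l < - (1/2) := l_neg_itv _ b1.
have bk k : (- beta) ^+ k != 0 by rewrite expf_neq0// oppr_eq0 gt_eqF.
apply/seteqP; split=> [x [k [vl /(digit_neg0 _ _ _ b1 vl) E]]|x ptx].
  have vl' : l <= x / (- beta) ^+ k < l + 1.
    by case/andP: vl => /ltW v1 v2; rewrite v1 v2.
  have := orbit _ k vl'; rewrite E divfK// => -[_ [[p ptp ->]|[p [_ _ e1]]]].
    by rewrite addr0.
  by have := le_lt_trans e1 e0; rewrite ltxx.
have l1p : 0 < l + 1 by lra.
(* Bounding the absolute value by [l + 1] suffices, because [l + 1 < -l]. *)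
have [k hk] := expr_unbounded _ _ (`|x| / (l + 1)) b1.
have : `|x / (- beta) ^+ k| < l + 1.
  rewrite normrM normfV normrX normrN (gtr0_norm b0) ltr_pdivrMr ?exprn_gt0//.
  by rewrite mulrC -ltr_pdivrMr.
rewrite ltr_norml => vl.
have vl' : l < x / (- beta) ^+ k < l + 1 by lra.
exists k; split=> //; apply/digit_neg0 => //.
apply: related0 (orbit _ k _) _; last by rewrite divfK.
by case/andP: vl' => /ltW -> ->.
Qed.

End NegativeBase.

(** * The quadratic bases *)

Lemma fixed_point_limit (P : bool -> seq bool) :
  (exists a w, P false = false :: a :: w) -> (forall X, 0 < size (P X))%N ->
  exists u, is_limit (fun k => iter k (morphism P) [:: false]) u.
Proof.
move=> [a [w P0]] Ps; apply: limit_exists => [k|k].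
  elim: k => [|k /prefixP[x E]]; first by rewrite /= morphism1 P0.
  by rewrite [iter k.+2 _ _]iterS {2}E morphism_cat -iterS prefix_prefix.
suff: exists2 v, iter k (morphism P) [:: false] = false :: v & (k <= size v)%N.
  by move=> [v -> kv]; apply: leq_trans kv _.
elim: k => [|k [v E kv]]; first by exists [::].
exists (a :: w ++ morphism P v); first by rewrite iterS E morphism_cons P0.
by rewrite /= size_cat; have := size_morphism _ v Ps; lia.
Qed.

(** Both sides are morphisms in [rev v], so a check on letters suffices. *)
Lemma morphism_rev_conj (s psi P : bool -> seq bool) :
  (forall X, morphism s (psi X) = morphism P (rev (s X))) ->
  forall v, morphism s (morphism psi (rev v)) = morphism P (rev (morphism s v)).
Proof.
by move=> H v; rewrite rev_morphism !morphism_comp; apply: eq_morphism.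
Qed.

(** Splitting letters by [s] carries the chain to the iterates of [w -> P (rev w)], seeded by the
    image of the central letters [1|0]. *)
Lemma language_neg_chain (s psi P : bool -> seq bool) (z : int -> bool) w :
  (forall X, 0 < size (s X))%N ->
  is_limit (fun k => rev (neg_chain psi k).1) (fun i => z (Negz i)) ->
  is_limit (fun k => (neg_chain psi k).2) (fun i => z (Posz i)) ->
  (forall X, morphism s (psi X) = morphism P (rev (s X))) ->
  language_int (morph_int (morphism s) z) w <->
  factor_lang (fun v => morphism P (rev v)) (s true ++ s false) w.
Proof.
move=> s0 Lneg Lpos conj.
have Ls : is_limit ((fun v => rev (morphism s (rev v))) \o
    (fun k => rev (neg_chain psi k).1)) (fun i => morph_int (morphism s) z (Negz i)).
  apply: limit_morph Lneg => [x y|v]; first by rewrite rev_cat morphism_cat rev_cat.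
  by rewrite size_rev -{1}(size_rev v) size_morphism.
have Rs : is_limit (morphism s \o (fun k => (neg_chain psi k).2))
    (fun i => morph_int (morphism s) z (Posz i)).
  by apply: limit_morph Lpos => [x y|v]; rewrite ?morphism_cat ?size_morphism.
rewrite (language_intP _ _ _ _ Ls Rs).
have E k : rev (((fun v => rev (morphism s (rev v))) \o
      (fun k => rev (neg_chain psi k).1)) k) ++
    (morphism s \o (fun k => (neg_chain psi k).2)) k =
    iter k (fun v => morphism P (rev v)) (s true ++ s false).
  rewrite /= !revK -morphism_cat neg_chain_cat.
  apply: etrans (iter_conj _ _ _ _ _ (morphism_rev_conj _ _ _ conj)) _.
  by rewrite morphism_cons morphism1.
by split=> -[k wk]; exists k; move: wk; rewrite E.
Qed.

(** * The case [beta^2 = m beta + n] *)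

Section QuadraticAdd.
Variables (R : realType) (m n : nat) (beta : R).
Hypotheses (n1 : (1 <= n)%N) (nm : (n < m)%N) (b1 : 1 < beta)
  (root_beta : beta ^+ 2 = m%:R * beta + n%:R).

Let P X := if X then nseq n false else rcons (nseq m false) true.
Let psi X := nseq (if X then (m + n).-1 else m.-1) false ++ [:: true].
Let b0 : 0 < beta. Proof. exact: lt_trans b1. Qed.
Let nR : 1 <= n%:R :> R. Proof. by rewrite ler1n. Qed.
Let nmR : n%:R + 1 <= m%:R :> R. Proof. by rewrite natr1 ler_nat. Qed.

Let beta_eq : beta = m%:R + n%:R / beta.
Proof.
by apply: (mulIf (lt0r_neq0 b0)); rewrite mulrDl divfK ?gt_eqF// -root_beta expr2.
Qed.

Let P_false : P false = nseq m.-1 false ++ [:: false; true].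
Proof.
have E : (m = m.-1 + 1)%N by lia.
by rewrite /P {1}E nseqD -cats1 -catA.
Qed.

Let ratio_itv : 0 < n%:R / beta < 1.
Proof.
have r0 : 0 < n%:R / beta by rewrite divr_gt0//; have := nR; lra.
by rewrite r0 ltr_pdivrMr// mul1r; have := nmR; have := beta_eq; lra.
Qed.

Let P_limit : exists u, is_limit (fun k => iter k (morphism P) [:: false]) u.
Proof.
apply: fixed_point_limit => [|[]]; rewrite ?size_rcons ?size_nseq//.
by rewrite /P; case: m nm => // -[|k] h; [lia|do 2!eexists].
Qed.

Let psi_limits : exists z : int -> bool,
  is_limit (fun k => rev (neg_chain psi k).1) (fun i => z (Negz i)) /\
  is_limit (fun k => (neg_chain psi k).2) (fun i => z (Posz i)).
Proof.
apply: neg_chain_limits => [||X].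
- by exists (nseq m.-1 false); rewrite -cats1.
- rewrite /psi; have -> : (m + n).-1 = (m + n).-2.+1 by lia.
  by eexists.
by rewrite size_cat size_nseq; case: X => /=; lia.
Qed.

Let u_betaE u : is_limit (fun k => iter k (morphism P) [:: false]) u ->
  u_beta_add n beta = u.
Proof.
move=> Lu; have /andP[r0 r1] := ratio_itv.
(* [P 1 = 0^n] is read as [n.-1] unit tiles followed by a last unit tile. *)
apply: (@coding_word_Zbeta _ _ _ (fun X => if X then n.-1 else m)
  (fun X => if X then false else true) P) => //.
- by case.
- by case=> //; apply: ltW.
- by case=> //=; case: n n1 => // k _; rewrite -cats1 -(nseqD k 1) addn1.
- case; rewrite /= ?mulr1//.
  by rewrite mulrC divfK ?gt_eqF// natr1 prednK.
by rewrite gt_eqF.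
Qed.

Let u_neg_betaE z : is_limit (fun k => rev (neg_chain psi k).1) (fun i => z (Negz i)) ->
  is_limit (fun k => (neg_chain psi k).2) (fun i => z (Posz i)) ->
  u_neg_beta_add n beta = z.
Proof.
move=> Lneg Lpos; have /andP[r0 r1] := ratio_itv.
have m0 : (0 < m)%N by lia.
have lb := l_neg_eq _ _ b1; have := l_neg_itv _ _ b1; set l := l_neg beta in lb *.
move=> l01; have rb : beta * (n%:R / beta) = n%:R by rewrite mulrC divfK ?gt_eqF.
apply: coding_wordE => [[]/=|/=|]; [lra|lra|by rewrite lt_eqF//; lra|].
apply/esym; apply: (@Zneg_beta_positions _ _ _ psi _ b1 _ _ _ Lneg Lpos m (m - n)) => //.
- by case=> /=; lra.
- move=> X; rewrite len_cat len_nseq len_cons len_nil.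
  have pm : m.-1%:R + 1 = m%:R :> R by rewrite natr1 prednK.
  have pmn : (m + n).-1%:R + 1 = m%:R + n%:R :> R.
    by rewrite natr1 prednK ?natrD//; lia.
  by have := beta_eq; case: X => /=; lra.
- by lia.
(* [e = n / beta + l], and [n + n / beta < m + n / beta = beta = -l (beta + 1)]. *)
- have : n%:R / beta * (beta + 1) < - l * (beta + 1).
    by rewrite mulrDr divfK ?gt_eqF//; have := nmR; have := beta_eq; lra.
  by rewrite ltr_pM2r ?addr_gt0// -/l; have := beta_eq; lra.
(* [-beta e = beta - n + l], and [beta >= m]. *)
- have : beta * (beta * l + l) = beta * - beta by rewrite lb.
  rewrite natrB ?(ltnW nm)//; have := root_beta; have := beta_eq.
  by rewrite -/l expr2; lra.
- case; [exists false, (nseq n.-1 false ++ [:: true])|exists true, [::] => //].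
  have E : ((m + n).-1 = m.-1 + n.-1.+1)%N by lia.
  by rewrite /psi E nseqD -catA.
exists (nseq m false); split; last first.
  by rewrite len_nseq natrB ?(ltnW nm)//=; lra.
have E : ((m + n).-1 = m + (m.-1 - (m - n)))%N by lia.
by rewrite /psi E nseqD -catA.
Qed.

Lemma language_add : language_nat (u_beta_add n beta) =
  language_int (morph_int pi_tilde_morph (u_neg_beta_add n beta)).
Proof.
have [u Lu] := P_limit; have [z [Lneg Lpos]] := psi_limits.
rewrite (u_betaE _ Lu) (u_neg_betaE _ Lneg Lpos); apply: funext => w; apply: propext.
have conj X : morphism (fun a : bool => if a then [:: false; true] else [:: false])
    (psi X) = morphism P (rev (if X then [:: false; true] else [:: false])).
  rewrite morphism_cat morphism_nseq1// morphism1; case: X.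
    have -> : ((m + n).-1 = n + m.-1)%N by lia.
    by rewrite morphism_cons morphism1 P_false nseqD -catA.
  by rewrite morphism1 P_false.
rewrite (language_natP _ _ _ Lu) (language_neg_chain _ psi P _ _ _ Lneg Lpos)//.
  by apply: (mirror_lang_add m n) => //; lia.
by case.
Qed.

(** For [n = 1] the morphism 1 -> 10 carries two steps of the chain to [P] applied twice, without
    conjugation; two steps bring the right half back to the right. *)
Lemma word_add : n = 1%N -> u_beta_add n beta =
  morph_nat pi_morph (nonneg_part (u_neg_beta_add n beta)).
Proof.
move=> nE; have [u Lu] := P_limit; have [z [Lneg Lpos]] := psi_limits.
rewrite (u_betaE _ Lu) (u_neg_betaE _ Lneg Lpos).
pose s a := if a then [:: true; false] else [:: false].
have Ls : is_limit (morphism s \o (fun k => (neg_chain psi k).2))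
    (morph_nat pi_morph (nonneg_part z)).
  by apply: limit_morph Lpos => [x y|v]; rewrite ?morphism_cat ?size_morphism//; case.
apply: (limit_uniq _ _ _ _ double Lu Ls) => k; first by lia.
have Em : nseq m false = false :: nseq m.-1 false.
  by rewrite -[LHS]/(nseq m false) -{1}(prednK (ltnW (leq_ltn_trans n1 nm))).
have Emn : (m + n).-1 = m by rewrite nE addn1.
have spsi X : morphism s (psi X) =
    nseq (if X then m else m.-1) false ++ [:: true; false].
  by rewrite morphism_cat morphism_nseq1// morphism1; case: X; rewrite ?Emn.
have P_true : P true = [:: false] by rewrite /P nE.
have shift j : false :: morphism s (morphism psi (nseq j false)) =
    rcons (morphism P (nseq j false)) false.
  elim: j => // j; set N := nseq j false => IH.
  rewrite -[nseq j.+1 _]/(false :: N) !morphism_cons morphism_cat rcons_cat -IH.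
  by rewrite spsi /P cat_rcons Em -catA.
(* The last 0 of the image of [psi 1] travels to the right end by [shift], where it is read as
   [P 1]. *)
have zeros j : morphism s (morphism psi (true :: nseq j false)) =
    morphism P (rcons (nseq j.+1 false) true).
  rewrite -cats1 -[nseq j.+1 _]/(false :: nseq j false) morphism_cat !morphism_cons.
  by rewrite morphism_cat spsi -!catA P_true cats1 -shift /P cat_rcons.
have step v : morphism s (morphism psi (rev (morphism psi (rev v)))) =
    morphism P (morphism P (morphism s v)).
  rewrite rev_morphism revK !morphism_comp; apply: eq_morphism => X.
  have -> : rev (psi X) = true :: nseq (if X then (m + n).-1 else m.-1) false.
    by rewrite rev_cat rev_nseq.
  rewrite -!morphism_comp zeros.
  case: X; last by rewrite morphism1 -[nseq _.+1 _]/(false :: nseq m.-1 false) -Em.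
  by rewrite Emn [morphism P (s true)]morphism_cons P_true morphism1.
elim: k => // k IH; rewrite doubleS !iterS IH /=.
by rewrite step.
Qed.

End QuadraticAdd.

(** * The case [beta^2 = m beta - n] *)

Section QuadraticSub.
Variables (R : realType) (m n : nat) (beta : R).
Hypotheses (n1 : (1 <= n)%N) (nm : (n + 2 <= m)%N) (b1 : 1 < beta)
  (root_beta : beta ^+ 2 = m%:R * beta - n%:R).

Let a (X : bool) := if X then (m - n - 2)%N else (m - 2)%N.
Let P X := nseq (a X).+1 false ++ [:: true].
Let Q X := nseq (a X) false ++ [:: true; false].
Let psi X := nseq (a false) false ++
  true :: (if X then nseq (a true) false ++ [:: true] else [::]).
Let b0 : 0 < beta. Proof. exact: lt_trans b1. Qed.
Let nR : 1 <= n%:R :> R. Proof. by rewrite ler1n. Qed.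
Let nmR : n%:R + 2 <= m%:R :> R. Proof. by rewrite -natrD ler_nat. Qed.

Let beta_eq : beta = m%:R - n%:R / beta.
Proof.
by apply: (mulIf (lt0r_neq0 b0)); rewrite mulrBl divfK ?gt_eqF// -root_beta expr2.
Qed.

(* (beta - 1) (beta - (m - 1)) = m - 1 - n > 0 *)
Let beta_gt : m%:R - 1 < beta.
Proof.
have : 0 < (beta - 1) * (beta - (m%:R - 1)).
  rewrite (_ : _ * _ = beta ^+ 2 - m%:R * beta + m%:R - 1); last by ring.
  by rewrite root_beta; have := nmR; lra.
by rewrite pmulr_rgt0 ?subr_gt0.
Qed.

Let ratio_itv : 0 < n%:R / beta < 1.
Proof.
rewrite divr_gt0//=; last by have := nR; lra.
by rewrite ltr_pdivrMr// mul1r; have := nmR; have := beta_gt; lra.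
Qed.

Let aR X : (a X)%:R = m%:R - 2 - (if X then n%:R else 0) :> R.
Proof.
by case: X; rewrite /a ?natrB; [ring|lia|lia|ring|lia].
Qed.

Let P_limit : exists u, is_limit (fun k => iter k (morphism P) [:: false]) u.
Proof.
apply: fixed_point_limit => [|X]; rewrite ?size_cat ?size_nseq//.
exists false, (nseq (m - 3) false ++ [:: true]).
by rewrite /P /a (_ : m - 2 = (m - 3).+1)%N//; lia.
Qed.

Let psi_limits : exists z : int -> bool,
  is_limit (fun k => rev (neg_chain psi k).1) (fun i => z (Negz i)) /\
  is_limit (fun k => (neg_chain psi k).2) (fun i => z (Posz i)).
Proof.
apply: neg_chain_limits => [||X].
- by exists (nseq (a false) false); rewrite -cats1.
- exists (behead (psi true)); rewrite /psi /a.
  by rewrite (_ : m - 2 = (m - 3).+1)%N//; lia.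
by rewrite size_cat size_nseq /a /=; lia.
Qed.

Let u_betaE u : is_limit (fun k => iter k (morphism P) [:: false]) u ->
  u_beta_sub n beta = u.
Proof.
move=> Lu; have /andP[r0 r1] := ratio_itv.
apply: (@coding_word_Zbeta _ _ _ (fun X => (a X).+1) (fun=> true) P) => //.
- by case=> /=; lra.
- by case=> /=; lra.
- by move=> X; rewrite -cats1.
- have rb : beta * (n%:R / beta) = n%:R by rewrite mulrC divfK ?gt_eqF.
  by move=> X; rewrite -natr1 aR; have := beta_eq; case: X => /=; lra.
by rewrite gt_eqF//=; lra.
Qed.

Let u_neg_betaE z : is_limit (fun k => rev (neg_chain psi k).1) (fun i => z (Negz i)) ->
  is_limit (fun k => (neg_chain psi k).2) (fun i => z (Posz i)) ->
  u_neg_beta_sub n beta = z.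
Proof.
move=> Lneg Lpos; have /andP[r0 r1] := ratio_itv.
have lb := l_neg_eq _ _ b1; have := l_neg_itv _ _ b1; set l := l_neg beta in lb *.
move=> l01; have rb : beta * (n%:R / beta) = n%:R by rewrite mulrC divfK ?gt_eqF.
apply: coding_wordE => [[]/=|/=|]; [lra|lra|by rewrite lt_eqF//; lra|].
have m1 : (m.-1)%:R = m%:R - 1 :> R by rewrite -subn1 natrB//; lia.
have ma : (m.-1.-1 = a false)%N by rewrite /a; lia.
apply/esym; apply: (@Zneg_beta_positions _ _ _ psi _ b1 _ _ _ Lneg Lpos m.-1 n) => //.
- by case=> /=; lra.
- move=> X; rewrite len_cat len_nseq len_cons; have := beta_eq.
  by case: X; rewrite ?len_cat ?len_nseq ?len_cons len_nil ?aR /=; lra.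
- by lia.
- by lia.
(* [e = 1 - n / beta + l], and the left side is [beta + 1 - n - n / beta < beta] because
   [n >= 1]. *)
- have : (1 - n%:R / beta) * (beta + 1) < - l * (beta + 1).
    by rewrite mulrBl !mulrDr divfK ?gt_eqF//; have := nR; lra.
  by rewrite ltr_pM2r ?addr_gt0// -/l m1; have := beta_eq; lra.
(* Equality holds here: [-beta e = n + l]. *)
- have : beta * (beta * l + l) = beta * - beta by rewrite lb.
  by rewrite m1; have := root_beta; rewrite -/l expr2; lra.
- by move=> X; rewrite ma; do 2!eexists.
(* This word has length [m - n / beta = beta]. *)
exists (nseq (a false) false ++ [:: true]); split; last first.
  by rewrite len_cat len_nseq len_cons len_nil aR /=; have := beta_eq; lra.
by rewrite -catA (_ : m.-1.-1 - n = a true)%N// /a; lia.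
Qed.

Lemma language_sub : language_nat (u_beta_sub n beta) =
  language_int (morph_int pi_morph (u_neg_beta_sub n beta)).
Proof.
have [u Lu] := P_limit; have [z [Lneg Lpos]] := psi_limits.
rewrite (u_betaE _ Lu) (u_neg_betaE _ Lneg Lpos); apply: funext => w; apply: propext.
(* Splitting sends [psi 0] to [Q 0] and [psi 1] to [Q 0 Q 1], so [Q] takes the place of [P]. *)
have conj X : morphism (fun b : bool => if b then [:: true; false] else [:: false])
    (psi X) = morphism Q (rev (if X then [:: true; false] else [:: false])).
  rewrite morphism_cat morphism_nseq1// morphism_cons; case: X.
    rewrite morphism_cat morphism_nseq1// morphism1.
    by rewrite morphism_cons morphism1 /Q -!catA.
  by rewrite morphism1.
rewrite (language_natP _ _ _ Lu) (language_neg_chain _ psi Q _ _ _ Lneg Lpos)//.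
  by apply: (mirror_lang_sub a P Q) => //; rewrite /a; lia.
by case.
Qed.

End QuadraticSub.

Theorem theorem4p5 (R : realType) :
  (forall (m n : nat) (beta : R),
     (1 <= n)%N -> (n < m)%N ->
     1 < beta -> root ('X^2 - m%:R *: 'X - n%:R%:P) beta ->
     language_nat (u_beta_add n beta)
       = language_int (morph_int pi_tilde_morph (u_neg_beta_add n beta))
     /\ (n = 1%N ->
         u_beta_add n beta
           = morph_nat pi_morph (nonneg_part (u_neg_beta_add n beta))))
  /\
  (forall (m n : nat) (beta : R),
     (1 <= n)%N -> (n + 2 <= m)%N ->
     1 < beta -> root ('X^2 - m%:R *: 'X + n%:R%:P) beta ->
     language_nat (u_beta_sub n beta)
       = language_int (morph_int pi_morph (u_neg_beta_sub n beta))).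
Proof.
split=> m n beta n1 nm b1; rewrite rootE !hornerE => /eqP rb.
  have E : beta ^+ 2 = m%:R * beta + n%:R by lra.
  by split; [apply: language_add E|apply: word_add E].
by apply: (language_sub _ m) => //; lra.
Qed.
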